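(* Let $\mathcal{X}$ and $\mathcal{Y}$ be finite nonempty sets, let $M$ be any Markov transition matrix indexed by $\mathcal{X}\times\mathcal{X}$, and let $\mathcal{M}=\{M(y): y\in\mathcal{Y}\}$ be any stepping decomposition of $M$, i.e. any family of entrywise nonnegative matrices indexed by $\mathcal{X}\times\mathcal{X}$ with $\sum_{y\in\mathcal{Y}}M(y)=M$. Then the corresponding $\alpha$-chain, with Markov operator $T_{\mathcal{M}}:C(\Delta)\to C(\Delta)$, is an e-chain; that is, for each $f\in C(\Delta)$ the set of functions $\{T_{\mathcal{M}}^n f: n>0\}$ is equicontinuous on $\Delta$.
   Context: Let $s=|\mathcal{X}|$, and let $\Delta\subset\mathbb{R}^s$ be the simplex of probability measures on $\mathcal{X}$, viewed as row vectors, with the usual Euclidean topology. A Markov transition matrix is an entrywise nonnegative $s\times s$ matrix all of whose rows sum to $1$. Let $e$ be the column vector of length $s$ with all entries $1$. $C(\Delta)$ is the space of continuous real-valued functions on $\Delta$ with the sup norm. The matrices $M(y)$ are called stepping matrices. The $\alpha$-chain associated with $\mathcal{M}$ is the Markov chain on $\Delta$ which moves from $\alpha\in\Delta$ to $\frac{\alpha M(y)}{\alpha M(y)e}$ with probability $\alpha M(y)e$, for $y\in\mathcal{Y}$; that is, its transition kernel is $P(\alpha,A)=\sum_{y}\alpha M(y)e$, the sum being over those $y\in\mathcal{Y}$ with $\alpha M(y)e>0$ and $\frac{\alpha M(y)}{\alpha M(y)e}\in A$. The chain is weak Feller, with Markov operator $T_{\mathcal{M}}:C(\Delta)\to C(\Delta)$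 given by $$(T_{\mathcal{M}}f)(\alpha)=\sum_{y\in\mathcal{Y}}(\alpha M(y)e)\,f\!\left(\frac{\alpha M(y)}{\alpha M(y)e}\right),$$ where any term with $\alpha M(y)e=0$ is set equal to $0$. A weak Feller chain with compact state space $S$ and Markov operator $T$ on $C(S)$ is called an e-chain if for each $f\in C(S)$ the set $\{T^nf:n>0\}$ is equicontinuous. *)

(* Defs.v *)
From HB Require Import structures.
From mathcomp Require Import all_boot all_order all_algebra.
From mathcomp Require Import all_classical all_reals all_analysis.
From mathcomp Require Import measurable_realfun lra.
Import numFieldNormedType.Exports.

Set Implicit Arguments.
Unset Strict Implicit.
Unset Printing Implicit Defensive.

Import Order.TTheory GRing.Theory Num.Theory.
Local Open Scope classical_set_scope.
Local Open Scope ring_scope.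

Definition simplex (R : realType) (n : nat) : set 'rV[R]_n :=
  [set a | (forall i, 0 <= a 0 i) /\ \sum_i a 0 i = 1].
Arguments simplex : clear implicits.

(* The simplex as a topological space, with the topology induced by 'rV[R]_n.
   The argument hn only serves to make the type pointed, as required by the
   measurable structures of the library. *)
Definition Simplex (R : realType) (n : nat) (hn : (0 < n)%N) : Type :=
  set_type (simplex R n).
Arguments Simplex : clear implicits.

Section simplex_structures.
Variables (R : realType) (n : nat) (hn : (0 < n)%N).

HB.instance Definition _ := SubType.copy (Simplex R n hn) (set_type (simplex R n)).
HB.instance Definition _ := Choice.copy (Simplex R n hn) (set_type (simplex R n)).

Lemma simplex_delta : delta_mx 0 (Ordinal hn) \in simplex R n.
Proof.
rewrite inE; split => [i|]; first by rewrite mxE ler0n.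
rewrite (bigD1 (Ordinal hn)) //= mxE !eqxx /= big1 ?addr0 // => i ne_i.
by rewrite mxE (negbTE ne_i).
Qed.

HB.instance Definition _ :=
  isPointed.Build (Simplex R n hn) (Sub (delta_mx 0 (Ordinal hn)) simplex_delta : Simplex R n hn).
HB.instance Definition _ :=
  PseudoMetric.copy (Simplex R n hn) (set_type (simplex R n)).
End simplex_structures.

Definition borel (S : ptopologicalType) := g_sigma_algebraType (@open S).

Lemma continuous_borel_measurable (R : realType) (S : ptopologicalType)
  (f : S -> R) : continuous f -> measurable_fun [set: borel S] f.
Proof.
move=> /continuousP cf; apply: (measurability _ (RGenOpens.measurableE R)).
move=> _ [_ [a [b ->] <-]]; rewrite setTI.
by apply: sub_sigma_algebra; apply: cf; exact: itv_open.
Qed.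

(* The operator must map C(S) to itself (the weak Feller property); the
   identity between extended reals includes the finiteness of the integral. *)
Record weak_feller_chain (R : realType) (S : ptopologicalType) := {
  chain_kernel : R.-pker (borel S) ~> (borel S);
  markov_op : continuousType S R -> continuousType S R;
  markov_opE : forall (f : continuousType S R) (x : S),
    ((markov_op f x)%:E = \int[chain_kernel x]_(z in [set: borel S]) (f z)%:E)%E
}.

(* The pointwise topological formulation of equicontinuity; the uniform one is
   equivalent as S is compact. *)
Definition e_chain (R : realType) (S : ptopologicalType)
    (c : weak_feller_chain R S) : Prop :=
  compact [set: S] /\
  forall f : continuousType S R,
    equicontinuous [set k | (0 < k)%N]
      (fun k => iter k (markov_op c) f : S -> R).

Definition transition_matrix (R : realType) (n : nat) (M : 'M[R]_n) : Prop :=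
  (forall i j, 0 <= M i j) /\ (forall i, \sum_j M i j = 1).

(* Ms is a family, so repeated matrices are allowed. *)
Definition stepping_decomposition (R : realType) (n : nat) (Y : finType)
    (M : 'M[R]_n) (Ms : Y -> 'M[R]_n) : Prop :=
  (forall y i j, 0 <= Ms y i j) /\ \sum_y Ms y = M.

Section alpha_chain.
Variables (R : realType) (n : nat) (hn : (0 < n)%N) (Y : finType).
Variables (M : 'M[R]_n) (Ms : Y -> 'M[R]_n).
Local Notation Delta := (Simplex R n hn).
Implicit Types (a : Delta) (y : Y).

(* a M(y) e *)
Definition step_prob y a : R :=
  ((val a *m Ms y) *m (const_mx 1 : 'cV[R]_n)) 0 0.

(* The default value a is only taken when step_prob y a = 0, see val_step and
   step0; such y contribute neither to alpha_kernel nor to alpha_op_fun. *)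
Definition step y a : Delta :=
  insubd a ((step_prob y a)^-1 *: (val a *m Ms y)).

Definition alpha_kernel a (A : set (borel Delta)) : \bar R :=
  (\sum_(y | (0 < step_prob y a)%R && (step y a \in A)) (step_prob y a)%:E)%E.

Definition alpha_op_fun (f : Delta -> R) a : R :=
  \sum_(y | step_prob y a != 0) step_prob y a * f (step y a).

Hypothesis (hM : transition_matrix M) (hMs : stepping_decomposition M Ms).

Lemma step_probE y a : step_prob y a = \sum_j (val a *m Ms y) 0 j.
Proof. by rewrite /step_prob mxE; apply: eq_bigr => j _; rewrite [X in _ * X]mxE mulr1. Qed.

Lemma mulms_ge0 y a j : 0 <= (val a *m Ms y) 0 j.
Proof.
have [a0 _] := set_mem (valP a).
by rewrite mxE sumr_ge0 // => i _; rewrite mulr_ge0 //; exact: (hMs.1).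
Qed.

Lemma step_prob_ge0 y a : 0 <= step_prob y a.
Proof. by rewrite step_probE sumr_ge0 // => j _; exact: mulms_ge0. Qed.

Lemma step_prob_gt0 y a : (0 < step_prob y a) = (step_prob y a != 0).
Proof. by rewrite lt0r step_prob_ge0 andbT. Qed.

Lemma sum_step_prob a : \sum_y step_prob y a = 1.
Proof.
have [_ a1] := set_mem (valP a).
rewrite -[RHS]a1 (eq_bigr _ (fun y _ => step_probE y a)) exchange_big /=.
under eq_bigr => j _ do
  (rewrite (_ : \sum_y _ = (val a *m M) 0 j);
   last by rewrite -hMs.2 mulmx_sumr summxE).
under eq_bigr => j _ do rewrite mxE.
rewrite exchange_big /=; apply: eq_bigr => i _.
by rewrite -mulr_sumr hM.2 mulr1.
Qed.

Lemma val_step y a : step_prob y a != 0 ->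
  val (step y a) = (step_prob y a)^-1 *: (val a *m Ms y).
Proof.
move=> w0; rewrite /step insubdK // inE; split => [i|].
  by rewrite mxE mulr_ge0 ?invr_ge0 ?step_prob_ge0 ?mulms_ge0.
under eq_bigr => i _ do rewrite mxE.
by rewrite -mulr_sumr -step_probE mulVf.
Qed.

Lemma val_continuous : continuous (fun a => val a : 'rV[R]_n).
Proof. exact: (@initial_continuous (simplex R n) 'rV[R]_n set_val). Qed.

Lemma coord_val_continuous i : continuous (fun a => (val a : 'rV[R]_n) 0 i).
Proof.
move=> a; apply: (@continuous_comp _ _ _ (fun a : Delta => val a : 'rV[R]_n)
  (fun v : 'rV[R]_n => v 0 i)); first exact: val_continuous.
exact: coord_continuous.
Qed.

Lemma sum_continuous (T : topologicalType) (I : finType) (g : I -> T -> R) x :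
  (forall i, {for x, continuous (g i)}) ->
  {for x, continuous (fun z => \sum_i g i z)}.
Proof. by move=> cg; apply: cvg_big => [|i _]; [exact: add_continuous|exact: cg]. Qed.

Lemma mulr_cst_continuous (T : topologicalType) (g : T -> R) c x :
  {for x, continuous g} -> {for x, continuous (fun z => g z * c)}.
Proof. by move=> cg; apply: cvgM; [exact: cg|exact: cvg_cst]. Qed.

Lemma mulms_continuous y j : continuous (fun a => (val a *m Ms y) 0 j).
Proof.
under eq_fun do rewrite mxE.
move=> a; apply: sum_continuous => i.
exact: mulr_cst_continuous (@coord_val_continuous i a).
Qed.

Lemma step_prob_continuous y : continuous (step_prob y).
Proof.
rewrite (_ : step_prob y = fun a => \sum_j (val a *m Ms y) 0 j); last first.
  by apply/funext => a; exact: step_probE.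
by move=> a; apply: sum_continuous => j; exact: mulms_continuous.
Qed.

Lemma simplex_closed : closed (simplex R n).
Proof.
rewrite (_ : simplex R n =
  (\bigcap_(i in [set: 'I_n]) [set a : 'rV[R]_n | 0 <= a 0 i]) `&`
  [set a : 'rV[R]_n | \sum_i a 0 i = 1]); last first.
  apply/seteqP; split => a /= [h1 h2]; split => //; first by move=> i _; exact: h1.
  by move=> i; exact: h1.
apply: closedI.
  apply: closed_bigI => i _.
  apply: (@closed_comp _ _ (fun a : 'rV[R]_n => a 0 i) [set x | 0 <= x]).
    by move=> a _; exact: coord_continuous.
  exact: closed_ge.
apply: (@closed_comp _ _ (fun a : 'rV[R]_n => \sum_i a 0 i) [set x | x = 1]).
  by move=> a _; apply: sum_continuous => i; exact: coord_continuous.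
exact: closed_eq.
Qed.

Lemma simplex_set_compact : compact (simplex R n).
Proof.
apply: (subclosed_compact simplex_closed
  (rV_compact (fun i : 'I_n => @segment_compact R 0 1))).
move=> a [a0 a1] i /=; rewrite in_itv /= a0 /= -a1 (bigD1 i) //=.
by rewrite lerDl sumr_ge0.
Qed.

Lemma Simplex_compact : compact [set: Delta].
Proof.
pose g (v : 'rV[R]_n) : Delta := insubd (point : Delta) v.
have gK (a : Delta) : g (val a) = a by rewrite /g valKd.
have -> : [set: Delta] = g @` simplex R n.
  by apply/seteqP; split => // a _; exists (val a) => //; exact/set_mem/(valP a).
apply: continuous_compact; last exact: simplex_set_compact.
apply/subspace_sigL_continuousP.
rewrite (_ : sigL _ _ = (id : simplex R n -> Delta)) //.
  by move=> a; exact: cvg_id.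
by apply/funext => a; exact: gK.
Qed.

Lemma mx_continuous (T : topologicalType) (g : T -> 'rV[R]_n) x :
  (forall j, {for x, continuous (fun z => g z 0 j)}) -> {for x, continuous g}.
Proof.
move=> cg U [P Pnbhs sPU].
have : \forall z \near x, forall j, P 0 j (g z 0 j).
  by apply: filter_forall => j; apply: cg; exact: Pnbhs.
by apply: filterS => z Pz; apply: sPU => i j; rewrite ord1.
Qed.

Lemma scale_inv_continuous (T : topologicalType) (u v : T -> R) x : u x != 0 ->
  {for x, continuous u} -> {for x, continuous v} ->
  {for x, continuous (fun z => (u z)^-1 * v z)}.
Proof. by move=> u0 cu cv; apply: cvgM; [exact: cvgV|exact: cv]. Qed.

Lemma near_neq0 (T : topologicalType) (u : T -> R) x :
  {for x, continuous u} -> u x != 0 -> \forall z \near x, u z != 0.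
Proof. by move=> cu; apply: cvgr_neq0; exact: cu. Qed.

Lemma near_step_prob_neq0 y a : step_prob y a != 0 ->
  \forall b \near a, step_prob y b != 0.
Proof.
exact: (near_neq0 (@step_prob_continuous y a)).
Qed.

Lemma step_continuous y a : step_prob y a != 0 -> {for a, continuous (step y)}.
Proof.
move=> w0 U [/= V [[W oW <-] Wa] sVU].
pose raw (b : Delta) := (step_prob y b)^-1 *: (val b *m Ms y).
have craw : {for a, continuous raw}.
  apply: mx_continuous => j.
  rewrite (_ : (fun b => raw b 0 j) =
    (fun b => (step_prob y b)^-1 * (val b *m Ms y) 0 j)); last first.
    by apply/funext => b; rewrite mxE.
  apply: scale_inv_continuous => //; first exact: step_prob_continuous.
  exact: mulms_continuous.
have nW : \forall b \near a, W (raw b).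
  by apply: craw; apply: open_nbhs_nbhs; split => //; rewrite /raw -val_step.
have nw := near_step_prob_neq0 w0.
apply: filterS2 nW nw => b Wb wb; apply: sVU => /=.
by rewrite /raw -val_step in Wb.
Qed.

Lemma continuous_bounded (f : Delta -> R) : continuous f ->
  exists C, forall a, `|f a| <= C.
Proof.
move=> cf.
have ne : [set: Delta] !=set0 by exists point.
have cnf : {within [set: Delta], continuous (fun a => `|f a|)}.
  apply: continuous_subspaceT => a; apply: continuous_comp; first exact: cf.
  exact: norm_continuous.
have [c _ fc] := compact_EVT_max ne Simplex_compact cnf.
by exists `|f c| => a; apply: fc; rewrite inE.
Qed.

Lemma squeeze_mul_continuous (T : topologicalType) (u v : T -> R) x C :
  u x = 0 -> {for x, continuous u} -> (forall z, `|v z| <= C) ->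
  {for x, continuous (fun z => u z * v z)}.
Proof.
move=> u0 cu vC; rewrite /prop_for /continuous_at u0 mul0r.
apply: (norm_cvg0 (V := R^o)).
apply: (@squeeze_cvgr _ _ _ _ (fun=> 0) (fun z => `|u z| * C)).
- by apply: nearW => z; rewrite normr_ge0 /= normrM ler_wpM2l.
- exact: cvg_cst.
- rewrite -[X in _ --> X](mul0r C); apply: cvgM; last exact: cvg_cst.
  rewrite -[X in _ --> X](normr0 R) -u0; apply: cvg_norm; exact: cu.
Qed.

Lemma alpha_op_funE f a :
  alpha_op_fun f a = \sum_y step_prob y a * f (step y a).
Proof.
rewrite /alpha_op_fun big_mkcond /=; apply: eq_bigr => y _.
by case: eqP => //= ->; rewrite mul0r.
Qed.

Lemma alpha_op_continuous (f : Delta -> R) :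
  continuous f -> continuous (alpha_op_fun f).
Proof.
move=> cf; rewrite (_ : alpha_op_fun f = fun a =>
  \sum_y step_prob y a * f (step y a)); last first.
  by apply/funext => a; exact: alpha_op_funE.
have [C fC] := continuous_bounded cf.
move=> a; apply: sum_continuous => y.
have [w0|w0] := eqVneq (step_prob y a) 0.
  by apply: (squeeze_mul_continuous (C := C)) => //; exact: step_prob_continuous.
apply: continuousM; first exact: step_prob_continuous.
by apply: continuous_comp; [exact: step_continuous|exact: cf].
Qed.

Definition weighted_dirac y a : {measure set (borel Delta) -> \bar R} :=
  if 0 < step_prob y a then
    (mscale (NngNum (normr_ge0 (step_prob y a))) (dirac (step y a : borel Delta))
      : {measure set (borel Delta) -> \bar R})
  else mzero.

Definition weighted_diracs a (k : nat) : {measure set (borel Delta) -> \bar R} :=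
  match insub k : option 'I_#|Y| with
  | Some i => weighted_dirac (enum_val i) a
  | None => mzero
  end.

Lemma sum_weighted_diracs a (F : {measure set (borel Delta) -> \bar R} -> \bar R) :
  (\sum_(k < #|Y|) F (weighted_diracs a k) = \sum_y F (weighted_dirac y a))%E.
Proof.
transitivity (\sum_(y in Y) F (weighted_dirac y a))%E; last by [].
rewrite [RHS]big_enum_val; apply: eq_bigr => i _.
by rewrite /weighted_diracs valK.
Qed.

Lemma weighted_diracE y a A : weighted_dirac y a A =
  if (0 < step_prob y a) && (step y a \in A) then (step_prob y a)%:E else 0%E.
Proof.
rewrite /weighted_dirac; case: ifP => //= w0.
by rewrite /mscale /= diracE gtr0_norm //; case: (_ \in _);
  rewrite ?mule1 ?mule0.
Qed.

Lemma alpha_kernelE a A :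
  alpha_kernel a A = msum (weighted_diracs a) #|Y| A.
Proof.
rewrite /msum (sum_weighted_diracs a (fun m => m A)) /alpha_kernel.
by rewrite big_mkcond /=; apply: eq_bigr => y _; rewrite weighted_diracE.
Qed.
Let alpha_kernel_msum a : alpha_kernel a = msum (weighted_diracs a) #|Y|.
Proof. by apply/funext => A; exact: alpha_kernelE. Qed.

Let alpha_kernel0 a : alpha_kernel a set0 = 0%E.
Proof. by rewrite alpha_kernel_msum measure0. Qed.

Let alpha_kernel_ge0 a A : (0 <= alpha_kernel a A)%E.
Proof. by rewrite alpha_kernel_msum measure_ge0. Qed.

Let alpha_kernel_sigma_additive a : semi_sigma_additive (alpha_kernel a).
Proof. by rewrite alpha_kernel_msum; exact: measure_semi_sigma_additive. Qed.

HB.instance Definition _ a := isMeasure.Build _ (borel Delta) R (alpha_kernel a)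
  (@alpha_kernel0 a) (@alpha_kernel_ge0 a) (@alpha_kernel_sigma_additive a).

Lemma step0 y a : step_prob y a = 0 -> step y a = a.
Proof.
rewrite /step => ->; rewrite invr0 scale0r /insubd insubN //.
rewrite notin_setE => -[_]; rewrite big1 => [|i _]; last by rewrite mxE.
by move/eqP; rewrite eq_sym oner_eq0.
Qed.

Lemma alpha_kernelT a : alpha_kernel a [set: borel Delta] = 1%E.
Proof.
rewrite /alpha_kernel -(sum_step_prob a) -sumEFin [LHS]big_mkcond /=.
apply: eq_bigr => y _; rewrite in_setT andbT step_prob_gt0.
by case: eqP => //= ->.
Qed.

Lemma measurable_step y :
  measurable_fun [set: borel Delta] (step y : borel Delta -> borel Delta).
Proof.
apply: (@measurability _ _ (borel Delta) (borel Delta) setT _ (@open Delta) erefl).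
move=> _ [U oU <-]; rewrite setTI.
pose V := [set a : Delta | step_prob y a != 0].
have -> : step y @^-1` U = (V `&` step y @^-1` U) `|` (~` V `&` U).
  apply/seteqP; split => a /=; rewrite /V /=.
    have [w0 Ua|w0 Ua] := eqVneq (step_prob y a) 0; last by left.
    right; split; first by move/negP.
    by have := Ua; rewrite step0.
  by move=> [[_ //]|[/negP/negPn/eqP w0 Ua]]; rewrite step0.
have oV : open V.
  rewrite openE => a Va; exact: near_step_prob_neq0.
have oVU : open (V `&` step y @^-1` U).
  rewrite openE => a [Va Ua]; apply: filterI; first exact: near_step_prob_neq0.
  by apply: step_continuous => //; exact: open_nbhs_nbhs.
apply: measurableU; first exact: sub_sigma_algebra.
apply: measurableI; last exact: sub_sigma_algebra.
by apply: measurableC; exact: sub_sigma_algebra.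
Qed.

Lemma measurable_alpha_kernel (A : set (borel Delta)) : measurable A ->
  measurable_fun [set: borel Delta] (alpha_kernel ^~ A).
Proof.
move=> mA.
rewrite (_ : alpha_kernel ^~ A =
  (fun a => \sum_y (step_prob y a * \1_A (step y a))%:E)%E); last first.
  apply/funext => a; rewrite /alpha_kernel [LHS]big_mkcond /=.
  apply: eq_bigr => y _; rewrite indicE step_prob_gt0.
  by case: eqP => /= [->|_]; rewrite ?mul0r //; case: (_ \in _);
    rewrite ?mulr1 ?mulr0.
apply: emeasurable_sum => y; apply/measurable_EFinP; apply: measurable_funM.
  exact: (continuous_borel_measurable (@step_prob_continuous y)).
apply: (measurableT_comp (f := \1_A : borel Delta -> R)) => //.
exact: measurable_step.
Qed.
Lemma ge0_integral_alpha_kernel a (g : borel Delta -> \bar R) :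
  measurable_fun [set: borel Delta] g -> (forall z, 0 <= g z)%E ->
  (\int[alpha_kernel a]_(z in [set: borel Delta]) g z =
   \sum_y (step_prob y a)%:E * g (step y a))%E.
Proof.
move=> mg g0.
transitivity
  (\int[msum (weighted_diracs a) #|Y|]_(z in [set: borel Delta]) g z)%E.
  by apply: eq_measure_integral => A _ _; exact: alpha_kernelE.
rewrite ge0_integral_measure_sum //.
rewrite (sum_weighted_diracs a
  (fun m => \int[m]_(z in [set: borel Delta]) g z)%E).
apply: eq_bigr => y _; rewrite /weighted_dirac step_prob_gt0.
have [->|w0] := eqVneq (step_prob y a) 0.
  by rewrite integral_measure_zero mul0e.
rewrite ge0_integral_mscale // integral_dirac // diracT mul1e /=.
by rewrite ger0_norm // step_prob_ge0.
Qed.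

Lemma integral_alpha_kernel a (f : Delta -> R) : continuous f ->
  (\int[alpha_kernel a]_(z in [set: borel Delta]) (f z)%:E =
   (alpha_op_fun f a)%:E)%E.
Proof.
move=> cf.
have mf : measurable_fun [set: borel Delta] (fun z : borel Delta => (f z)%:E).
  by apply/measurable_EFinP; exact: continuous_borel_measurable.
rewrite integralE !ge0_integral_alpha_kernel //; first last.
- exact: measurable_funepos.
- exact: measurable_funeneg.
rewrite alpha_op_funE.
under eq_bigr do rewrite funeposE -EFin_max -EFinM.
under [X in (_ - X)%E]eq_bigr do rewrite funenegE -EFinN -EFin_max -EFinM.
rewrite !sumEFin -EFinB -sumrB; congr EFin; apply: eq_bigr => y _.
rewrite -mulrBr; congr *%R.
by have [f0|f0] := leP (f (step y a)) 0; have [] := leP (- f (step y a)) 0;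
  lra.
Qed.

(* The two hypotheses are arguments because the kernel and Feller properties
   declared below as canonical instances depend on them. *)
Definition alpha_transition of transition_matrix M
  & stepping_decomposition M Ms :
  borel Delta -> {measure set (borel Delta) -> \bar R} := alpha_kernel.

Local Notation alpha_ker := (alpha_transition hM hMs).

HB.instance Definition _ := isKernel.Build _ _ (borel Delta) (borel Delta) R
  alpha_ker measurable_alpha_kernel.
HB.instance Definition _ := Kernel_isProbability.Build _ _
  (borel Delta) (borel Delta) R alpha_ker alpha_kernelT.

Definition alpha_op of transition_matrix M & stepping_decomposition M Ms :=
  fun f : continuousType Delta R => alpha_op_fun f.

HB.instance Definition _ (f : continuousType Delta R) :=
  isContinuous.Build Delta R (alpha_op hM hMs f)
    (alpha_op_continuous (@cts_fun _ _ f)).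

Definition alpha_chain : weak_feller_chain R Delta := {|
  chain_kernel := alpha_ker;
  markov_op := fun f => alpha_op hM hMs f;
  markov_opE := fun f a => esym (integral_alpha_kernel a (@cts_fun _ _ f))
|}.
End alpha_chain.
Arguments alpha_chain {R n} hn {Y M Ms} hM hMs.

(* Main.v *)
Require Import Defs.
From mathcomp Require Import all_boot all_order all_algebra.
From mathcomp Require Import all_classical all_reals all_analysis.
From mathcomp Require Import lra.

(** Extend a function [g] on the simplex to the cone of nonnegative vectors by
homogeneity of degree one, [G (s *: a) = s * g a]. The normalisation in the
chain then disappears: the extension of [T g] is [v |-> \sum_y G (v *m M(y))],
a sum of [G] over linear images of [v]. Moreover [v |-> (v *m M(y))_y] does not
increase the total l1 norm, because [\sum_y M(y)] has unit row sums, and it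
preserves the total mass of nonnegative vectors. Hence an estimate
[`|G u - G v| <= L * |u - v|_1 + eps * |v|_1] on the cone passes from [g] to
[T g] with the same [L] and [eps] (lemma [cone_lipschitz_alpha_op]), and so to
all iterates.

For every [eps > 0], each continuous [f] satisfies such an estimate with some
[L]: by compactness [`|f a - f b| <= eps + K * |a - b|_1] on the simplex (lemma
[continuous_lipschitz_up_to]), and boundedness of [f] carries this over to the
cone (lemma [cone_lipschitz_of_simplex]). At mass one the estimate reads
[`|T^k f a - T^k f b| <= L * |a - b|_1 + eps] for all [k], which is
equicontinuity. *)

Set Implicit Arguments.
Unset Strict Implicit.
Unset Printing Implicit Defensive.

Import Order.TTheory GRing.Theory Num.Theory.
Import numFieldNormedType.Exports.
Local Open Scope classical_set_scope.
Local Open Scope ring_scope.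

(** * The l1 norm of row vectors *)

Section l1norm.
Variables (R : realType) (n : nat).
Implicit Types u v : 'rV[R]_n.

Definition l1norm v : R := \sum_i `|v 0 i|.

Lemma l1norm_ge0 v : 0 <= l1norm v.
Proof. by apply: sumr_ge0. Qed.

Lemma l1norm_eq0 v : l1norm v = 0 -> v = 0.
Proof.
move/eqP; rewrite psumr_eq0 // => /allP v0.
apply/rowP => i; rewrite mxE; apply/eqP; rewrite -normr_eq0.
by apply: v0; rewrite mem_index_enum.
Qed.

Lemma l1normD u v : l1norm (u + v) <= l1norm u + l1norm v.
Proof.
by rewrite -big_split /=; apply: ler_sum => i _; rewrite mxE ler_normD.
Qed.

Lemma l1normZ c v : l1norm (c *: v) = `|c| * l1norm v.
Proof. by rewrite mulr_sumr; apply: eq_bigr => i _; rewrite mxE normrM. Qed.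

Lemma norm_sum_le_l1norm v : `|\sum_i v 0 i| <= l1norm v.
Proof. exact: ler_norm_sum. Qed.

(** After the triangle inequality, [`|v 0 i|] has the coefficient
[\sum_j \sum_y Ms y i j = \sum_j M i j = 1]. *)
Lemma sum_l1norm_mulms (Y : finType) (M : 'M[R]_n) (Ms : Y -> 'M[R]_n) v :
  transition_matrix M -> stepping_decomposition M Ms ->
  \sum_y l1norm (v *m Ms y) <= l1norm v.
Proof.
move=> [_ M1] [Ms0 MsE].
apply: (@le_trans _ _ (\sum_y \sum_j \sum_i `|v 0 i| * Ms y i j)).
  apply: ler_sum => y _; apply: ler_sum => j _; rewrite mxE.
  apply: le_trans (ler_norm_sum _ _ _) _.
  by apply: ler_sum => i _; rewrite normrM (ger0_norm (Ms0 _ _ _)).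
rewrite exchange_big /=.
under eq_bigr do rewrite exchange_big /=.
rewrite exchange_big /=; apply: ler_sum => i _.
under eq_bigr => j _ do rewrite -mulr_sumr -summxE MsE.
by rewrite -mulr_sumr M1 mulr1.
Qed.

End l1norm.

(** * Lipschitz estimates up to an error, on the cone over the simplex *)

Section cone_lipschitz.
Variables (R : realType) (n : nat) (hn : (0 < n)%N).
Local Notation Delta := (Simplex R n hn).
Implicit Types (f g : Delta -> R) (a b : Delta).

(** The estimate [`|G u - G v| <= L * |u - v|_1 + eps * |v|_1] for the
homogeneous extension [G] of [g], at [u = s *: a] and [v = t *: b]; polar
coordinates avoid choosing a value of [u / |u|_1] at the apex of the cone. *)
Definition cone_lipschitz (L eps : R) g : Prop :=
  forall s t a b, 0 <= s -> 0 <= t ->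
    `|s * g a - t * g b| <= L * l1norm (s *: val a - t *: val b) + eps * t.

Lemma sum_val_simplex a : \sum_i (val a : 'rV[R]_n) 0 i = 1.
Proof. by have [_] := set_mem (valP a). Qed.

Lemma l1norm_simplex a : l1norm (val a) = 1.
Proof.
have [a0 a1] := set_mem (valP a).
by rewrite -[RHS]a1; apply: eq_bigr => i _; rewrite ger0_norm.
Qed.

Lemma dist_mass_le_l1norm s t a b :
  `|s - t| <= l1norm (s *: val a - t *: val b : 'rV[R]_n).
Proof.
rewrite (_ : s - t = \sum_i (s *: val a - t *: val b : 'rV[R]_n) 0 i).
  exact: norm_sum_le_l1norm.
under eq_bigr do rewrite !mxE.
by rewrite sumrB -!mulr_sumr !sum_val_simplex !mulr1.
Qed.

(** Moving from [s *: a] to [t *: b] costs a change of mass, controlled by the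
bound [C] on [f], and then a change of direction at mass [t], at l1 distance
[t * |a - b|_1 <= |t - s| + |s a - t b|_1 <= 2 * |s a - t b|_1]. *)
Lemma cone_lipschitz_of_simplex f (C K eps : R) : 0 <= K ->
  (forall a, `|f a| <= C) ->
  (forall a b, `|f a - f b| <= eps + K * l1norm (val a - val b : 'rV[R]_n)) ->
  cone_lipschitz (C + K * 2) eps f.
Proof.
move=> K0 fC fK s t a b s0 t0.
set d := l1norm _.
have st : `|s - t| <= d by exact: dist_mass_le_l1norm.
have C0 : 0 <= C := le_trans (normr_ge0 _) (fC a).
have tab : t * l1norm (val a - val b : 'rV[R]_n) <= d *+ 2.
  rewrite -{1}(ger0_norm t0) -l1normZ.
  rewrite (_ : t *: _ = (t - s) *: val a + (s *: val a - t *: val b)); last first.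
    by rewrite scalerBr scalerBl addrA subrK.
  apply: le_trans (l1normD _ _) _.
  by rewrite l1normZ l1norm_simplex mulr1 distrC mulr2n lerD2r.
rewrite (_ : s * f a - t * f b = (s - t) * f a + t * (f a - f b)); last by lra.
apply: le_trans (ler_normD _ _) _; rewrite !normrM (ger0_norm t0).
have h1 : `|s - t| * `|f a| <= d * C by apply: ler_pM.
have h2 := ler_wpM2l t0 (fK a b).
have h3 := ler_wpM2l K0 tab.
by move: h1 h2 h3; rewrite -mulr_natr; lra.
Qed.

Lemma l1dist_continuous (T : topologicalType) (u v : T -> Delta) x :
  {for x, continuous u} -> {for x, continuous v} ->
  {for x, continuous (fun z => l1norm (val (u z) - val (v z) : 'rV[R]_n))}.
Proof.
move=> cu cv; rewrite /l1norm; apply: sum_continuous => i.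
have cc (w : T -> Delta) : {for x, continuous w} ->
    {for x, continuous (fun z => (val (w z) : 'rV[R]_n) 0 i)}.
  move=> cw; apply: (@continuous_comp _ _ _ w
    (fun a : Delta => (val a : 'rV[R]_n) 0 i)); first exact: cw.
  exact: coord_val_continuous.
rewrite (_ : (fun z : T => _) = fun z : T =>
  `|(val (u z) : 'rV[R]_n) 0 i - (val (v z) : 'rV[R]_n) 0 i|); last first.
  by apply/funext => z; rewrite !mxE.
by apply: cvg_norm; apply: cvgB; exact: cc.
Qed.

(** A uniform-continuity statement in which the modulus is traded for a slope
[K]. A given pair [(a, b)] has a neighbourhood on which every large [K] works:
near the diagonal [`|f a - f b| < eps] by continuity, and off it the distance
stays away from 0 while [f] is bounded. Compactness of the set of pairs makes
[K] uniform. *)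
Lemma continuous_lipschitz_up_to f (eps : R) : continuous f -> 0 < eps ->
  exists2 K, 0 <= K &
    forall a b, `|f a - f b| <= eps + K * l1norm (val a - val b : 'rV[R]_n).
Proof.
move=> cf eps0.
have [C fC] := continuous_bounded cf.
have cpt : compact ([set: Delta] `*` [set: Delta]).
  by apply: compact_setX; exact: Simplex_compact.
pose P (K : R) (p : Delta * Delta) := 0 <= K /\
  `|f p.1 - f p.2| <= eps + K * l1norm (val p.1 - val p.2 : 'rV[R]_n).
have : \forall K \near +oo, [set: Delta] `*` [set: Delta] `<=` P K.
  apply: ((compact_near_coveringP _).1 cpt) => -[a b] _.
  pose d (p : Delta * Delta) := l1norm (val p.1 - val p.2 : 'rV[R]_n).
  have [d0|dn0] := eqVneq (d (a, b)) 0.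
    have ab : a = b by apply/val_inj/eqP; rewrite -subr_eq0; apply/eqP/l1norm_eq0.
    have cff : {for (a, b), continuous (fun p : Delta * Delta => `|f p.1 - f p.2|)}.
      apply: cvg_norm; apply: cvgB.
      - by apply: (@continuous_comp _ _ _ (@fst Delta Delta) f);
          [exact: cvg_fst|exact: cf].
      - by apply: (@continuous_comp _ _ _ (@snd Delta Delta) f);
          [exact: cvg_snd|exact: cf].
    have nf : \forall p \near (a, b), `|f p.1 - f p.2| < eps.
      by apply: (cvgr_lt _ cff); rewrite /= ab subrr normr0.
    exists ([set p | `|f p.1 - f p.2| < eps], [set K | 0 <= K]).
      by split => //=; exact: nbhs_pinfty_ge.
    move=> [p K] /= [fp K0]; split => //.
    by apply: le_trans (ltW fp) _; rewrite lerDl mulr_ge0 // l1norm_ge0.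
  have dgt0 : 0 < d (a, b) by rewrite lt0r dn0 l1norm_ge0.
  have nd : \forall p \near (a, b), d (a, b) / 2 < d p.
    by apply: (cvgr_gt _ (@l1dist_continuous _ _ _ (a, b) cvg_fst cvg_snd)); rewrite /= -/(d (a, b)); lra.
  exists ([set p | d (a, b) / 2 < d p], [set K | C *+ 2 / (d (a, b) / 2) <= K]).
    by split => //=; apply: nbhs_pinfty_ge; rewrite num_real.
  move=> [p K] /= [dp KC].
  have C0 : 0 <= C := le_trans (normr_ge0 _) (fC a).
  have h0 : 0 < d (a, b) / 2 by lra.
  have K0 : 0 <= K.
    by apply: le_trans _ KC; apply: divr_ge0; [rewrite mulrn_wge0|exact: ltW].
  split => //=; apply: (@le_trans _ _ (C *+ 2)).
    apply: le_trans (ler_normB _ _) _; rewrite mulr2n.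
    by apply: lerD; exact: fC.
  move: KC; rewrite ler_pdivrMr // => KC.
  have := ler_wpM2l K0 (ltW dp); rewrite -/(d p); lra.
move=> /filter_ex[K PK]; exists K => [|a b].
  by have [] := PK (point, point) (conj I I).
by have [] := PK (a, b) (conj I I).
Qed.

End cone_lipschitz.

(** * Invariance under the chain and equicontinuity *)

Section alpha_op.
Variables (R : realType) (n : nat) (hn : (0 < n)%N) (Y : finType).
Variables (M : 'M[R]_n) (Ms : Y -> 'M[R]_n).
Hypotheses (hM : transition_matrix M) (hMs : stepping_decomposition M Ms).
Local Notation Delta := (Simplex R n hn).

Lemma step_prob_scale_step y (a : Delta) :
  step_prob Ms y a *: (val (step Ms y a) : 'rV[R]_n) = val a *m Ms y.
Proof.
have [w0|w0] := eqVneq (step_prob Ms y a) 0; last first.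
  by rewrite (val_step hMs) // scalerA mulfV // scale1r.
(* a nonnegative vector of total mass 0 vanishes *)
rewrite w0 scale0r; apply/esym/l1norm_eq0.
rewrite -[RHS]w0 step_probE; apply: eq_bigr => j _.
by rewrite ger0_norm // (mulms_ge0 hMs).
Qed.

(** In polar coordinates the image of [s *: a] under [M(y)] is
[(s * step_prob y a) *: step y a], so the estimate for [g] applies to each
[y]; summing over [y], the distances contract and the masses add up to [t]. *)
Lemma cone_lipschitz_alpha_op (L eps : R) (g : Delta -> R) : 0 <= L ->
  cone_lipschitz L eps g -> cone_lipschitz L eps (alpha_op_fun Ms g).
Proof.
move=> L0 gL s t a b s0 t0.
rewrite !alpha_op_funE !mulr_sumr -sumrB.
apply: le_trans (ler_norm_sum _ _ _) _.
pose v : 'rV[R]_n := s *: val a - t *: val b.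
apply: (@le_trans _ _
  (\sum_y (L * l1norm (v *m Ms y) + eps * (t * step_prob Ms y b)))).
  apply: ler_sum => y _; rewrite !mulrA.
  have := gL (s * step_prob Ms y a) (t * step_prob Ms y b)
    (step Ms y a) (step Ms y b).
  rewrite -!scalerA !step_prob_scale_step /v mulmxBl -!scalemxAl -!mulrA.
  by apply; rewrite mulr_ge0 // (step_prob_ge0 hMs).
rewrite big_split /= -!mulr_sumr (sum_step_prob hM hMs) mulr1 lerD2r.
by apply: ler_wpM2l => //; exact: (sum_l1norm_mulms v hM hMs).
Qed.

Lemma cone_lipschitz_iter (L eps : R) (f : continuousType Delta R) k :
  0 <= L -> cone_lipschitz L eps f ->
  cone_lipschitz L eps (iter k (markov_op (alpha_chain hn hM hMs)) f).
Proof.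
by move=> L0 fL; elim: k => //= k IHk; exact: cone_lipschitz_alpha_op.
Qed.

End alpha_op.

Theorem theorem1 (R : realType) (X Y : finType)
    (hX : (0 < #|X|)%N) (hY : (0 < #|Y|)%N)
    (M : 'M[R]_#|X|) (Ms : Y -> 'M[R]_#|X|)
    (hM : transition_matrix M) (hMs : stepping_decomposition M Ms) :
  e_chain (alpha_chain hX hM hMs).
Proof.
split; first exact: Simplex_compact.
move=> f a E; rewrite -entourage_ballE => -[e /= e0 eE].
have cf : continuous (f : Simplex R #|X| hX -> R) by exact: cts_fun.
have e20 : 0 < e / 2 by lra.
have [C fC] := continuous_bounded cf.
have [K K0 fK] := continuous_lipschitz_up_to cf e20.
have fL := cone_lipschitz_of_simplex K0 fC fK.
set L := C + K * 2 in fL.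
have L0 : 0 <= L.
  by rewrite addr_ge0 ?mulr_ge0 //; exact: le_trans (normr_ge0 _) (fC a).
have cd : {for a, continuous (fun b : Simplex R #|X| hX =>
    l1norm (val a - val b : 'rV[R]__) * L)}.
  apply: mulr_cst_continuous; apply: l1dist_continuous.
    exact: cst_continuous.
  exact: cvg_id.
have nd : \forall b \near a,
    l1norm (val a - val b : 'rV[R]_#|X|) * L < e / 2.
  apply: (cvgr_lt _ cd); rewrite subrr /l1norm big1 ?mul0r // => i _.
  by rewrite mxE normr0.
apply: filterS nd => b ab k _; apply: eE; rewrite /= /ball /=.
have := cone_lipschitz_iter hM hMs k L0 fL a b ler01 ler01.
rewrite !mul1r !scale1r mulr1; lra.
Qed.
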